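(* Let $l,t,s,n$ be integers with $3\leq l\leq t$, $s\geq l+1$ and $n\geq 2s+1$. For integers $x$ define $$F_1(x)=(l-1)n+(t-1)\binom{x}{l}+\binom{2(s-x)+1}{2}-\left\lceil\frac{x(l-1)}{2}\right\rceil,$$ $$F_2(x)=(l-1)n+(t-1)\binom{x}{l}+ex(2(s-x)+1,K_{l,t})-\left\lceil\frac{x(l-1)}{2}\right\rceil-(2(s-x)+1)(l-1),$$ and let $r_1=\max\{F_1(x): x\in\mathbb{Z},\ \max\{2s-t+1,2l\}\leq 2x\leq 2s\}$ and $r_2=\max\{F_2(x): x\in\mathbb{Z},\ 2l\leq 2x\leq 2s-t\}$. Let $n(x)=x+(t-1)\binom{x}{l}+2(s-x)+1$ and $n_1=\max_{0\leq x\leq s}n(x)$. (i) If $n\geq n_1$, then $ex(n,\{K_{l,t},M_{s+1}\})\geq \max\{r_1,r_2\}$. (ii) If $s$ is sufficiently large (in terms of $l$ and $t$) and $n\geq 2\binom{3s}{2}$, then $$ex(n,\{K_{l,t},M_{s+1}\})\leq (l-1)n+(t-1)\binom{s}{l}-\left\lceil\frac{s(l-1)}{2}\right\rceil.$$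
   Context: All graphs are finite, simple and undirected. For a family $\mathscr{F}$ of graphs, a graph is $\mathscr{F}$-free if it contains no member of $\mathscr{F}$ as a (not necessarily induced) subgraph; $ex(n,\mathscr{F})$ is the maximum number of edges of an $\mathscr{F}$-free graph on $n$ vertices, and $ex(n,F)=ex(n,\{F\})$. $K_{l,t}$ is the complete bipartite graph with parts of sizes $l$ and $t$, and $M_{s+1}$ is the matching consisting of $s+1$ pairwise disjoint edges (so $M_{s+1}$-free means matching number at most $s$). *)

(* Defs.v *)
From mathcomp Require Import all_boot all_order all_algebra.
Set Implicit Arguments. Unset Strict Implicit. Unset Printing Implicit Defensive.

Definition graph n := {set {set 'I_n}}.

Definition is_graph n (E : graph n) : bool := [forall e in E, #|e| == 2].

Definition has_Klt (l t : nat) n (E : graph n) : bool :=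
  [exists A : {set 'I_n}, exists B : {set 'I_n},
     [&& #|A| == l, #|B| == t, [disjoint A & B] &
      [forall a in A, forall b in B, [set a; b] \in E]]].

Definition has_matching (k : nat) n (E : graph n) : bool :=
  [exists M : {set {set 'I_n}}, [&& M \subset E, #|M| == k & trivIset M]].

Definition ex (n : nat) (forb : forall m, graph m -> bool) : nat :=
  \max_(E : graph n | is_graph E && ~~ forb n E) #|E|.

Definition Klt_free l t := fun m (E : graph m) => has_Klt l t E.
Definition Klt_Ms_free l t s :=
  fun m (E : graph m) => has_Klt l t E || has_matching s.+1 E.

Definition ceil2 (a : nat) : nat := (a + 1) %/ 2.

Local Open Scope ring_scope.

Definition F1 (l t s n x : nat) : int :=
  ((l - 1) * n + (t - 1) * 'C(x, l) + 'C(2 * (s - x) + 1, 2))%:Z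
  - (ceil2 (x * (l - 1)))%:Z.

Definition F2 (l t s n x : nat) : int :=
  ((l - 1) * n + (t - 1) * 'C(x, l) + ex (2 * (s - x) + 1) (Klt_free l t))%:Z
  - (ceil2 (x * (l - 1)))%:Z - ((2 * (s - x) + 1) * (l - 1))%:Z.

Definition nx (l t s x : nat) : nat := x + (t - 1) * 'C(x, l) + 2 * (s - x) + 1.
Definition n1 (l t s : nat) : nat := \max_(x < s.+1) nx l t s x.

(* Main.v *)
(* Lower bound: on a set X of x vertices take a graph with maximum degree at most
   l - 1 and floor (x (l - 1) / 2) edges, and attach every vertex outside X to l - 1
   vertices of X, except that for each l-subset of X exactly t - 1 vertices are
   attached to the whole of it.  A clique (F1) or an extremal K_{l,t}-free graph (F2)
   on 2 (s - x) + 1 of the outer vertices is added.  A K_{l,t} with a part inside X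
   would need t vertices attached to the same l-subset, and any other one lives around
   the added clique or graph.

   Upper bound: let X be the set of vertices of degree > 3 (s + 1), x = #|X|.  Greedy
   extension of a maximal matching of G - X shows that G - X has a vertex cover of
   size 2 (s - x), hence O(s (s - x)) edges.  Writing d v for the number of
   neighbours of v in X, being K_{l,t}-free gives \sum_v C(d v, l) <= (t - 1) C(x, l)
   where v ranges over all vertices, those of X included.  Since d <= l - 1 + C(d, l),
   both e(X, V \ X) + 2 e(X) and e(X, V \ X) are controlled, and comparing 2 e(X) with
   x (l - 1) yields e(X, V \ X) + e(X) <= (l - 1) n + (t - 1) C(x, l)
   - ceil (x (l - 1) / 2).  For s large, the loss C(s, l) - C(x, l), which is at least
   (s - x) C(s, l) / s, dominates the edges of G - X. *)
Require Import Defs.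
From mathcomp Require Import all_boot all_order all_algebra.
From mathcomp Require Import zify.
Set Implicit Arguments. Unset Strict Implicit. Unset Printing Implicit Defensive.

Import GRing.Theory.

(** * Edges, neighbourhoods and K_{l,t}-free graphs *)

Lemma subset_of_card (T : finType) (A : {set T}) k : k <= #|A| ->
  exists2 B : {set T}, B \subset A & #|B| = k.
Proof.
case/card_geqP=> r [ru rs rA]; exists [set x in r].
  by apply/subsetP => x; rewrite inE => /rA.
by rewrite -rs cardsE; apply/card_uniqP.
Qed.

(** By Pascal's rule, each unit added to [d] from [d = l - 1] on raises ['C(d, l)] by at least
    one. *)
Lemma leq_bin_add l d : 0 < l -> d <= l - 1 + 'C(d, l).
Proof.
case: l => // l _; rewrite subn1 /=; elim: d => // d IHd; rewrite binS.
case: (leqP l d) => [ld|]; last by lia.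
by have : 0 < 'C(d, l); [rewrite bin_gt0 | lia].
Qed.

Section Neighbourhoods.

Variables (n : nat) (E : graph n).
Hypothesis gE : is_graph E.

Definition nbr v : {set 'I_n} := [set u | [set u; v] \in E].

Lemma card_edge e : e \in E -> #|e| = 2.
Proof. by move=> eE; apply/eqP/(forall_inP gE). Qed.

Lemma edgeP e v : e \in E -> v \in e -> exists2 u, u != v & e = [set u; v].
Proof.
move=> /card_edge/eqP/cards2P[a [b [ab ->]]]; rewrite !inE => /orP[] /eqP->.
  by exists b; rewrite 1?eq_sym // setUC.
by exists a.
Qed.

Lemma nbr_neq u v : u \in nbr v -> u != v.
Proof.
rewrite inE => /card_edge; apply: contra_eq_neq => ->.
by rewrite setUid cards1.
Qed.

Lemma card_nbrI v (X : {set 'I_n}) :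
  #|nbr v :&: X| = #|[set e in E | (v \in e) && (e :\ v \subset X)]|.
Proof.
have <- : [set [set u; v] | u in nbr v :&: X]
          = [set e in E | (v \in e) && (e :\ v \subset X)].
  apply/setP => e; apply/imsetP/idP => [[u]|].
    rewrite !inE => /andP[uvE uX] ->; rewrite uvE !inE eqxx orbT /=.
    by apply/subsetP => w; rewrite !inE => /andP[/negPf->]; rewrite orbF => /eqP->.
  rewrite !inE => /and3P[eE ve /subsetP eX].
  have [u uv eE'] := edgeP eE ve; exists u => //; rewrite !inE -eE' eE /=.
  by apply: eX; rewrite eE' !inE uv eqxx.
rewrite card_in_imset // => u w /setIP[/nbr_neq uv _] /setIP[/nbr_neq wv _].
by move=> /setP/(_ u); rewrite !inE eqxx (negPf uv) /= orbF => /esym/eqP.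
Qed.

(** Incidences of [v] in [W] with edges whose other end lies in [X], counted by vertices and by
    edges. The bounds on edge sets below come from the contribution of one edge: 2 if it lies inside
    [X = W], at least 1 in the other cases. *)
Lemma handshake (W X : {set 'I_n}) :
  \sum_(v in W) #|nbr v :&: X|
  = \sum_(e in E) #|[set v in e | (v \in W) && (e :\ v \subset X)]|.
Proof.
under eq_bigr => v _ do rewrite card_nbrI -sum1_card.
under [RHS]eq_bigr => e _ do rewrite -sum1_card.
rewrite (exchange_big_dep (mem E)) /= => [|v e _]; last by rewrite inE => /andP[].
apply: eq_bigr => e eE; apply: eq_bigl => v; rewrite !inE eE /=.
by rewrite andbA [(v \in W) && _]andbC -andbA.
Qed.

Definition inner_edges (X : {set 'I_n}) := [set e in E | e \subset X].
Definition outer_edges (X : {set 'I_n}) := [set e in E | [disjoint e & X]].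
Definition cross_edges (X : {set 'I_n}) :=
  [set e in E | ~~ (e \subset X) & ~~ [disjoint e & X]].

Lemma card_inner_edges (X : {set 'I_n}) :
  2 * #|inner_edges X| <= \sum_(v in X) #|nbr v :&: X|.
Proof.
rewrite handshake mulnC -sum_nat_const.
rewrite [leqRHS](bigID (fun e : {set 'I_n} => e \subset X)) /= -[leqLHS]addn0 leq_add //.
rewrite (eq_bigl (fun e => (e \in E) && (e \subset X))) => [|e]; last by rewrite inE.
apply: leq_sum => e /andP[eE eX].
rewrite -(card_edge eE) subset_leq_card //; apply/subsetP => v ve.
by rewrite inE ve (subsetP eX) //= (subset_trans (subsetDl _ _)).
Qed.

Lemma card_cross_edges (X : {set 'I_n}) :
  #|cross_edges X| <= \sum_(v in ~: X) #|nbr v :&: X|.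
Proof.
rewrite handshake -sum1_card.
rewrite [leqRHS](bigID (fun e : {set 'I_n} => ~~ (e \subset X) && ~~ [disjoint e & X])) /=.
rewrite -[leqLHS]addn0 leq_add //.
rewrite (eq_bigl (fun e => (e \in E) && (~~ (e \subset X) && ~~ [disjoint e & X]))) => [|e];
  last by rewrite inE.
apply: leq_sum => e /and3P[eE /subsetPn[v ve vX] /pred0Pn[w /= /andP[we wX]]].
rewrite card_gt0; apply/set0Pn; exists v; rewrite !inE ve vX /=.
have [u uv eE'] := edgeP eE ve; apply/subsetP => z; rewrite !inE => /andP[zv].
rewrite eE' !inE (negPf zv) orbF => /eqP->.
move: we; rewrite eE' !inE => /orP[] /eqP wE; first by rewrite -wE.
by move: vX; rewrite -wE wX.
Qed.

Lemma card_edges_split (X : {set 'I_n}) :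
  #|E| <= #|outer_edges X| + #|cross_edges X| + #|inner_edges X|.
Proof.
apply: (@leq_trans #|outer_edges X :|: cross_edges X :|: inner_edges X|).
  apply: subset_leq_card; apply/subsetP => e eE; rewrite !inE eE /=.
  by case: (e \subset X); case: [disjoint e & X].
by rewrite (leq_trans (leq_card_setU _ _)) // leq_add2r leq_card_setU.
Qed.

Lemma card_edges_meeting (F : graph n) (C : {set 'I_n}) : F \subset E ->
  (forall e, e \in F -> ~~ [disjoint e & C]) ->
  #|F| <= \sum_(v in C) #|nbr v|.
Proof.
move=> /subsetP FE FC.
under eq_bigr => v _ do rewrite -[nbr v]setIT.
rewrite handshake -sum1_card [leqRHS](bigID (mem F)) /= -[leqLHS]addn0 leq_add //.
rewrite [leqLHS](eq_bigl (fun e => (e \in E) && (e \in F))) => [|e]; last first.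
  by case: (boolP (e \in F)) => [/FE->|_]; rewrite ?andbF.
apply: leq_sum => e /andP[_ /FC/pred0Pn[v /= /andP[ve vC]]].
by rewrite card_gt0; apply/set0Pn; exists v; rewrite !inE ve vC subsetT.
Qed.

End Neighbourhoods.

Section KltFree.

Variables (l t n : nat) (E : graph n).
Hypotheses (gE : is_graph E) (freeE : ~~ has_Klt l t E).

(** With [t] common neighbours, [A] would span a [K_{l,t}]; they avoid [A] because no vertex is its
    own neighbour. *)
Lemma card_common_nbr (A : {set 'I_n}) : #|A| = l ->
  #|[set v | A \subset nbr E v]| <= t - 1.
Proof.
move=> cA; rewrite leqNgt; apply: contra freeE => lt_t.
have [B BA cB] : exists2 B : {set 'I_n}, B \subset [set v | A \subset nbr E v] & #|B| = t.
  by apply: subset_of_card; lia.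
apply/existsP; exists A; apply/existsP; exists B; rewrite cA cB !eqxx /=.
apply/andP; split.
  apply/pred0P => v /=; apply/negP => /andP[vA /(subsetP BA)].
  by rewrite inE => /subsetP/(_ v vA)/(nbr_neq gE); rewrite eqxx.
apply/forall_inP => a aA; apply/forall_inP => b /(subsetP BA).
by rewrite inE => /subsetP/(_ a aA); rewrite inE.
Qed.

(** Double counting of the pairs of a vertex [v] and an [l]-subset of [X] inside its
    neighbourhood. *)
Lemma sum_bin_nbr (X : {set 'I_n}) :
  \sum_v 'C(#|nbr E v :&: X|, l) <= (t - 1) * 'C(#|X|, l).
Proof.
under eq_bigr => v _ do rewrite -cards_draws -sum1_card.
rewrite (exchange_big_dep (fun A : {set 'I_n} => (A \subset X) && (#|A| == l))) /=.
  rewrite mulnC -cards_draws -sum_nat_const.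
  rewrite [leqRHS](eq_bigl (fun A : {set 'I_n} => (A \subset X) && (#|A| == l))) => [|A];
    last by rewrite !inE.
  apply: leq_sum => A /andP[AX /eqP cA]; rewrite sum1dep_card.
  apply: leq_trans (card_common_nbr cA); apply: subset_leq_card.
  by apply/subsetP => v; rewrite !inE subsetI => /andP[/andP[]].
by move=> v A _; rewrite !inE subsetI => /andP[/andP[_ ->]].
Qed.

Lemma sum_nbr_le (W X : {set 'I_n}) : 0 < l ->
  \sum_(v in W) #|nbr E v :&: X| <= (l - 1) * #|W| + (t - 1) * 'C(#|X|, l).
Proof.
move=> l_gt0; apply: (@leq_trans (\sum_(v in W) (l - 1 + 'C(#|nbr E v :&: X|, l)))).
  by apply: leq_sum => v _; apply: leq_bin_add.
rewrite big_split /= sum_nat_const mulnC leq_add2l.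
apply: leq_trans (sum_bin_nbr X).
by rewrite [leqRHS](bigID (mem W)) /= leq_addr.
Qed.

End KltFree.

(** * Upper bound *)

(** From [l 'C(x, l) = x 'C(x - 1, l - 1)] and monotonicity of the binomial in its upper
    argument. *)
Lemma bin_slope l s x : 0 < l -> x <= s -> s * 'C(x, l) <= x * 'C(s, l).
Proof.
case: l => // l _ xs; rewrite -(leq_pmul2l (ltn0Sn l)) mulnCA -mul_bin_diag.
rewrite [leqRHS]mulnCA -mul_bin_diag mulnCA leq_mul2l leq_mul2l leq_bin2l ?orbT //.
by lia.
Qed.

Lemma leq_bin_diag m k j : 'C(m, k) <= 'C(m + j, k + j).
Proof. by elim: j => [|j]; rewrite ?addn0 // !addnS binS => /leq_trans-> //; apply: leq_addl. Qed.

(** After the factor [s / l] is taken out, ['C(s - 1, l - 1)] is at least ['C(s - l + 2, 2)],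
    quadratic in [s]; for [s >= 20 l] this beats [l (6 s + 6 + l)]. The factor [2 (3 s + 3) + l] is
    the cost of each vertex that [X] falls short of [s]. *)
Lemma bin_large l s : 3 <= l -> 20 * l <= s -> s * (2 * (3 * s + 3) + l) <= 'C(s, l).
Proof.
move=> l3 ls; have l0 : 0 < l by lia.
rewrite -(leq_pmul2l l0).
have := mul_bin_diag s l.-1; rewrite prednK // => <-.
rewrite mulnCA leq_mul2l; apply/orP; right.
have := leq_bin_diag (s - l + 2) 2 (l - 3).
have -> : s - l + 2 + (l - 3) = s.-1 by lia.
have -> : 2 + (l - 3) = l.-1 by lia.
apply: leq_trans; have := mul_bin_diag (s - l + 2) 1; rewrite bin1.
have [d ->] : exists d, s = 20 * l + d by exists (s - 20 * l); lia.
have -> : 20 * l + d - l + 2 = 19 * l + d + 2 by lia.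
have -> : (19 * l + d + 2).-1 = 19 * l + d + 1 by lia.
by move: 'C(_, _) => c; nia.
Qed.

(** * Extending matchings *)

Section Matchings.

Variables (n : nat) (E : graph n).
Hypothesis gE : is_graph E.

Lemma has_matchingS k (M : graph n) : M \subset E -> trivIset M -> k <= #|M| -> has_matching k E.
Proof.
move=> ME tM /subset_of_card[N NM cN]; apply/existsP; exists N.
by rewrite (subset_trans NM ME) cN eqxx (trivIsetS NM tM).
Qed.

Lemma card_cover_matching (M : graph n) : M \subset E -> #|cover M| <= 2 * #|M|.
Proof.
move=> /subsetP ME; apply: leq_trans (leq_card_cover M) _.
by rewrite mulnC -sum_nat_const leq_sum // => e /ME /(card_edge gE)->.
Qed.

Lemma matching_add e (M : graph n) : M \subset E -> trivIset M -> e \in E ->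
  [disjoint e & cover M] ->
  [/\ e |: M \subset E, trivIset (e |: M) & #|e |: M| = #|M|.+1].
Proof.
move=> ME tM eE dis.
have disM f : f \in M -> [disjoint e & f].
  by move=> fM; apply: disjointWr dis; apply: (bigcup_sup f).
have M0 : set0 \notin M.
  by apply/negP => /(subsetP ME)/(card_edge gE); rewrite cards0.
have [tM' eM] := trivIsetU1 disM tM M0.
by rewrite cardsU1 eM; split=> //; rewrite subUset sub1set eE.
Qed.

(* The vertices of [X] are matched one by one, each to a neighbour which is neither
   covered already nor in the part of [X] still to be matched. *)
Lemma greedy_matching s (M : graph n) (X : {set 'I_n}) : M \subset E -> trivIset M ->
  [disjoint cover M & X] -> (forall v, v \in X -> 3 * s < #|nbr E v|) ->
  #|M| + #|X| <= s -> has_matching (#|M| + #|X|) E.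
Proof.
move cX: #|X| => k; elim: k X M cX => [|k IHk] X M cX ME tM dis degX le_s.
  by apply: (has_matchingS ME tM); rewrite addn0.
have [v vX] : exists v, v \in X by apply/card_gt0P; rewrite cX.
have cX' : #|X :\ v| = k by have := cardsD1 v X; rewrite vX cX => -[].
(* At most [2 #|M| + #|X| <= 2 s] vertices are forbidden, and [v] has more than [3 s] neighbours. *)
have [w wv wC] : exists2 w, w \in nbr E v & w \notin cover M :|: X.
  apply/subsetPn; apply/negP => /subset_leq_card.
  have := degX v vX; have [+ _] := leq_card_setU (cover M) X.
  by have := card_cover_matching ME; rewrite cX; lia.
move: wC; rewrite inE negb_or => /andP[wM wX].
have eE : [set w; v] \in E by move: wv; rewrite inE.
have [|ME' tM' cM'] := @matching_add [set w; v] M ME tM eE.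
  apply/pred0P => u /=; apply/negP; rewrite !inE => /andP[/orP[]/eqP->].
    by apply/negP.
  by move=> vM; move: (disjointFr dis vM); rewrite vX.
rewrite addnS -addSn -cM'; apply: (IHk (X :\ v)) => //.
- rewrite /cover bigcup_setU big_set1 -/(cover M).
  apply/pred0P => u /=; apply/negP; rewrite !inE => /andP[/orP[/orP[]/eqP->|uM]].
  + by rewrite (negPf wX) andbF.
  + by rewrite eqxx.
  + by rewrite (disjointFr dis uM) andbF.
- by move=> u /setD1P[_ /degX].
- by rewrite cM' addSn -addnS.
Qed.

End Matchings.

(** * Counting the edges *)

Lemma leq_ceil2D a b : ceil2 (a + b) <= ceil2 a + b.
Proof. by rewrite /ceil2; lia. Qed.

(** By [bin_slope], going from [s] down to [x] loses at least the fraction [(s - x) / s] of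
    ['C(s, l)]. *)
Lemma bin_gain l s x q : 0 < l -> x <= s -> 0 < s -> s * q <= 'C(s, l) ->
  'C(x, l) + (s - x) * q <= 'C(s, l).
Proof.
move=> l0 xs s0 large; have slope := bin_slope l0 xs.
rewrite -(leq_pmul2l s0) mulnDr mulnCA (leq_trans (leq_add slope (leqnn _))) //.
apply: (@leq_trans (x * 'C(s, l) + (s - x) * 'C(s, l))); first by rewrite leq_add2l leq_mul.
by rewrite -mulnDl subnKC.
Qed.

(** Here [o] counts the edges avoiding [X] and [Z] those meeting it. Each of the [s - x] missing
    vertices gains [2 D + l]: [2 D] pays for [o], since [m <= s - x], and [l] for the growth of the
    ceiling. *)
Lemma upper_arith t x s m o D l cx cs Z R : 1 < t -> m + x <= s ->
  cx + (s - x) * (2 * D + l) <= cs -> o <= 2 * m * D ->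
  Z + ceil2 (x * (l - 1)) <= R + (t - 1) * cx ->
  o + Z + ceil2 (s * (l - 1)) <= R + (t - 1) * cs.
Proof.
move=> t1 ms gain le_o leZ.
have [d sE] : exists d, s = x + d by exists (s - x); lia.
have md : m <= d by lia.
have tgain : (t - 1) * cx + d * (2 * D + l) <= (t - 1) * cs.
  have ->: d = s - x by lia.
  apply: leq_trans (leq_mul (leqnn (t - 1)) gain).
  rewrite (mulnDr (t - 1)) leq_add2l leq_pmull //.
  by rewrite subn_gt0.
have oD : o <= d * (2 * D) by rewrite (leq_trans le_o) // -mulnA mulnCA leq_mul.
have := leq_ceil2D (x * (l - 1)) (d * (l - 1)); rewrite -mulnDl -sE.
have : d * (l - 1) <= d * l by rewrite leq_mul2l leq_subr orbT.
by move: tgain; rewrite (mulnDr d); lia.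
Qed.

(** With [i] inner and [c] cross edges: if [p <= 2 i], the ceiling of [p / 2] is at most [i] and the
    sum over all vertices suffices; otherwise [i] plus that ceiling is at most [p], and the sum
    outside [X] suffices. *)
Lemma edge_count_arith a b c i p q T N : 2 * i <= a -> c <= b ->
  a + b <= N + T -> b <= q + T -> N = p + q -> c + i + ceil2 p <= N + T.
Proof. by rewrite /ceil2 => *; case: (leqP p (2 * i)); lia. Qed.

Lemma card_edges_upper l t s n (E : graph n) : 3 <= l -> l <= t -> 20 * l <= s ->
  is_graph E -> ~~ has_Klt l t E -> ~~ has_matching s.+1 E ->
  #|E| + ceil2 (s * (l - 1)) <= (l - 1) * n + (t - 1) * 'C(s, l).
Proof.
move=> l3 lt ls gE freeE nomat.
(* The threshold is the degree [greedy_matching] asks for in a matching of size [s + 1]; outside [X]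
   degrees are at most [D]. *)
pose X := [set v | 3 * s.+1 < #|nbr E v|].
pose D := 3 * s + 3.
have [|M maxM _] := @maxset_exists _
    (fun M : graph n => (M \subset outer_edges E X) && trivIset M) set0.
  by rewrite sub0set; apply/trivIsetP => A B; rewrite inE.
have /andP[MO tM] := maxsetp maxM.
have ME : M \subset E by apply: subset_trans MO _; apply/subsetP => e; rewrite inE => /andP[].
have dis : [disjoint cover M & X].
  apply/pred0P => v /=; apply/negP => /andP[/bigcupP[e /(subsetP MO)]].
  by rewrite inE => /andP[_ /disjointFr eX] /eX->.
have cMX : #|M| + #|X| <= s.
  rewrite leqNgt; apply: contra nomat => gt_s.
  have [ms|sm] := leqP #|M| s; last exact: has_matchingS ME tM sm.
  (* [Y] is cut down so that the extended matching has exactly [s + 1] edges, the most the greedy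
     argument allows. *)
  have [Y YX cY] : exists2 Y : {set 'I_n}, Y \subset X & #|Y| = s.+1 - #|M|.
    by apply: subset_of_card; lia.
  have := @greedy_matching _ E gE s.+1 M Y ME tM.
  have -> : #|M| + #|Y| = s.+1 by lia.
  apply=> //; first by apply: disjointWr YX dis.
  by move=> v /(subsetP YX); rewrite inE.
(* By maximality of [M], the at most [2 #|M|] vertices it covers, all outside [X], meet every outer
   edge. *)
have cO : #|outer_edges E X| <= 2 * #|M| * D.
  apply: (@leq_trans (\sum_(v in cover M) D)).
    apply: (@leq_trans (\sum_(v in cover M) #|nbr E v|)).
      apply: card_edges_meeting => //.
        by apply/subsetP => e; rewrite inE => /andP[].
      move=> e eO; apply/negP => eM.
      have eE : e \in E by move: eO; rewrite inE => /andP[].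
      have [ME' tM' cM'] := matching_add gE ME tM eE eM.
      have := maxsetsup maxM _ (subsetUr [set e] M).
      rewrite subUset sub1set eO MO tM' => /(_ isT) eq.
      by move: cM'; rewrite eq => /n_Sn.
    apply: leq_sum => v vM; move: (disjointFr dis vM).
    by rewrite inE => /negbT; rewrite -leqNgt mulnSr.
  by rewrite sum_nat_const leq_mul2r (card_cover_matching gE ME) orbT.
have l0 : 0 < l by apply: ltn_trans l3.
have s0 : 0 < s by apply: leq_trans ls; rewrite muln_gt0.
have t1 : 1 < t by apply: leq_trans lt; apply: ltnW.
have S1 : \sum_(v in X) #|nbr E v :&: X| + \sum_(v in ~: X) #|nbr E v :&: X|
          <= (l - 1) * n + (t - 1) * 'C(#|X|, l).
  have := sum_nbr_le gE freeE [set: 'I_n] X l0; rewrite cardsT card_ord.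
  apply: leq_trans; rewrite [leqRHS](bigID (mem X)) leq_add //.
    by apply/eq_leq/eq_bigl => v; rewrite !inE.
  by apply/eq_leq/eq_bigl => v; rewrite !inE.
have S2 := sum_nbr_le gE freeE (~: X) X l0.
have I2 := card_inner_edges gE X.
have C1 := card_cross_edges gE X.
have split := card_edges_split E X.
have cXC := cardsC X; rewrite card_ord in cXC.
have EX : #|cross_edges E X| + #|inner_edges E X| + ceil2 (#|X| * (l - 1))
          <= (l - 1) * n + (t - 1) * 'C(#|X|, l).
  have ln : (l - 1) * n = #|X| * (l - 1) + (l - 1) * #|~: X|.
    by rewrite [#|X| * _]mulnC -mulnDr cXC.
  exact: edge_count_arith I2 C1 S1 S2 ln.
have gain := bin_gain l0 (leq_trans (leq_addl _ _) cMX) s0 (bin_large l3 ls).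
apply: leq_trans (upper_arith t1 cMX gain cO EX).
by rewrite addnA leq_add2r.
Qed.

(** * Lower bound *)

Lemma val_addZp m (i k : 'I_m.+1) :
  val (i + k)%R = if i + k < m.+1 then i + k else i + k - m.+1.
Proof.
rewrite /=; case: ltnP => [/modn_small //|le_m].
rewrite -[in LHS](subnK le_m) modnDr modn_small //.
by have := ltn_ord i; have := ltn_ord k; lia.
Qed.

Lemma card_ord_range m e : e < m -> #|[set k : 'I_m | 0 < k <= e]| = e.
Proof.
move=> em.
have -> : [set k : 'I_m | 0 < k <= e]
          = [set k : 'I_m | k <= e] :\ Ordinal (leq_ltn_trans (leq0n e) em).
  by apply/setP => k; rewrite !inE lt0n.
have := cardsD1 (Ordinal (leq_ltn_trans (leq0n e) em)) [set k : 'I_m | k <= e].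
rewrite inE leq0n /= add1n => cE; apply: succn_inj; rewrite -cE.
rewrite -sum1dep_card (eq_bigl (fun k : 'I_m => k < e.+1)) // -(big_ord_widen m (fun=> 1)) //.
by rewrite sum1_card card_ord.
Qed.

Lemma card_ord_eq m h (b : bool) : #|[set k : 'I_m | (k == h :> nat) && b]| <= b.
Proof.
case: b; last by rewrite leqn0 cards_eq0; apply/eqP/setP => k; rewrite !inE andbF.
by apply/card_le1_eqP => i j; rewrite !inE !andbT => /eqP ih /eqP jh;
  apply: val_inj; rewrite /= ih jh.
Qed.

Lemma card_range_or m e h (b : bool) (A : {set 'I_m}) : e < m ->
  (forall k, k \in A -> (0 < k <= e) || (k == h :> nat) && b) -> #|A| <= e + b.
Proof.
move=> em Ab; rewrite -[in leqRHS](card_ord_range em).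
apply: leq_trans (leq_add (leqnn _) (card_ord_eq m h b)).
apply: leq_trans (leq_card_setU _ _).1; apply: subset_leq_card.
by apply/subsetP => k /Ab; rewrite !inE.
Qed.

(* The circulant graph with differences [1 .. d./2]; when [d] is odd, a matching
   along the difference [x./2] supplies the missing degree. *)
Lemma near_regular x d : d < x -> exists H : graph x,
  [/\ is_graph H, forall v, #|nbr H v| <= d & x * d <= (2 * #|H|).+1].
Proof.
case: x => // m dm; pose e := d./2; pose h := m.+1./2.
have dE := odd_double_half d; rewrite -/e in dE.
have mE := odd_double_half m.+1; rewrite -/h in mE.
have em : e < m.+1 by move: dE; lia.
(* A pair is a start and a difference. For odd [d], [d < x] gives [e < h]; the starts below [h] make
   the edges of difference [h] disjoint and free of wraparound. *)
pose P := [set p : 'I_m.+1 * 'I_m.+1 |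
  (0 < p.2 <= e) || [&& odd d, p.2 == h :> nat & p.1 < h]].
pose phi (p : 'I_m.+1 * 'I_m.+1) := [set p.1; (p.1 + p.2)%R].
have P_gt0 i k : (i, k) \in P -> 0 < k.
  rewrite inE /= => /orP[/andP[]//|/and3P[od /eqP-> _]].
  by move: od dE mE; case: (odd d) => //; lia.
have neq_add (i k : 'I_m.+1) : (0 < k)%N -> i != (i + k)%R.
  by move=> k0; rewrite -{1}[i]addr0 (inj_eq (addrI i)); apply: contraTneq k0 => <-.
have phi_inj : {in P &, injective phi}.
  move=> [i k] [j k'] iP jP; rewrite /phi /= => eqs.
  have ik := neq_add i k (P_gt0 _ _ iP).
  have jk := neq_add j k' (P_gt0 _ _ jP).
  have : i \in [set j; (j + k')%R] by rewrite -eqs !inE eqxx.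
  have : (i + k)%R \in [set j; (j + k')%R] by rewrite -eqs !inE eqxx orbT.
  rewrite !inE => /orP[]/eqP e2 /orP[]/eqP e1.
  - by move: ik; rewrite e2 e1 eqxx.
  (* An edge read from both ends forces [k + k'] to be the modulus, so [k = k' = h]; but then one of
     the starts is at least [h]. *)
  - have := congr1 val e2; have := congr1 val e1; rewrite !val_addZp.
    move: iP jP; rewrite !inE /=.
    have := ltn_ord i; have := ltn_ord j; have := ltn_ord k; have := ltn_ord k'.
    by move: dE mE dm; case: (odd d); case: (odd m.+1); do 2 case: ifP; lia.
  - by move: e2; rewrite e1 => /addrI->.
  - by move: ik; rewrite e2 e1 eqxx.
exists (phi @: P); split.
- apply/forall_inP => _ /imsetP[[i k] /P_gt0 k0 ->].
  by rewrite cards2 neq_add.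
(* [A] and [B] hold the differences of the edges starting and ending at [v]. The difference [h]
   occurs in [A] only if [v < h] and in [B] only if [h <= v], so the total is at most
   [2 e + odd d = d]. *)
- move=> v; pose A := [set k | (v, k) \in P]; pose B := [set k | ((v - k)%R, k) \in P].
  have cA : #|A| <= e + (odd d && (v < h)).
    apply: (@card_range_or _ e h) => [|k]; first exact: em.
    by rewrite !inE /= andbCA.
  have cB : #|B| <= e + (odd d && (h <= v)).
    apply: (@card_range_or _ e h) => [|k]; first exact: em.
    rewrite !inE /= => /orP[->//|/and3P[-> /eqP kh lt_h]]; rewrite kh eqxx orbC /=.
    have := val_addZp (v - k)%R k; rewrite subrK => ->; rewrite kh.
    by move: lt_h; rewrite /=; move: (_ %% _) => c; move: mE; case: (odd m.+1); case: ifP; lia.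
  apply: (@leq_trans #|[set (v + k)%R | k in A] :|: [set (v - k)%R | k in B]|).
    apply: subset_leq_card; apply/subsetP => u; rewrite inE => /imsetP[[i k] ikP].
    rewrite /phi /= => eqs.
    have : i \in [set u; v] by rewrite eqs !inE eqxx.
    have : (i + k)%R \in [set u; v] by rewrite eqs !inE eqxx orbT.
    have ik := neq_add i k (P_gt0 _ _ ikP).
    rewrite !inE => /orP[]/eqP e2 /orP[]/eqP e1.
    + by move: ik; rewrite e2 e1 eqxx.
    + by apply/orP; left; rewrite -e2 e1; apply: imset_f; rewrite /A -e1 in_set.
    + apply/orP; right; have -> : u = (v - k)%R by rewrite -e2 addrK.
      by apply: imset_f; rewrite /B in_set -e2 addrK.
    + by move: ik; rewrite e2 e1 eqxx.
  apply: leq_trans (leq_card_setU _ _).1 _.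
  apply: leq_trans (leq_add (leq_imset_card _ _) (leq_imset_card _ _)) _.
  by apply: leq_trans (leq_add cA cB) _; move: dE; case: (odd d); case: ltnP; lia.
- rewrite card_in_imset //.
  have cP : m.+1 * e + odd d * h <= #|P|.
    pose P1 : {set 'I_m.+1 * 'I_m.+1} := setX setT [set k : 'I_m.+1 | 0 < k <= e].
    pose P2 : {set 'I_m.+1 * 'I_m.+1} := setX [set i : 'I_m.+1 | i < h] [set inord h].
    have P1P : P1 \subset P.
      by apply/subsetP => -[i k]; rewrite !inE /= => ->.
    have cP1 : #|P1| = m.+1 * e by rewrite cardsX cardsT card_ord card_ord_range.
    case od: (odd d); last by rewrite addn0 -cP1 subset_leq_card.
    have hm : h < m.+1 by move: mE dE dm; rewrite od; case: (odd m.+1); lia.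
    have cP2 : #|P2| = h.
      rewrite cardsX cards1 muln1 -sum1dep_card -(big_ord_widen _ (fun=> 1)) 1?ltnW //.
      by rewrite sum1_card card_ord.
    rewrite mul1n -cP1 -[X in _ + X]cP2.
    have /leqifP := leq_card_setU P1 P2.
    have -> : [disjoint P1 & P2].
      apply/pred0P => -[i k] /=; apply/negP; rewrite !inE /= => /and3P[/andP[_ ke] _ /eqP kh].
      by move: ke; rewrite kh inordK //; move: mE dE dm; rewrite od; case: (odd m.+1); lia.
    move=> /eqP <-; apply: subset_leq_card; rewrite subUset P1P.
    apply/subsetP => -[i k]; rewrite !inE /= od => /andP[-> /eqP->].
    by rewrite inordK // eqxx orbT.
  by move: cP dE mE dm; case: (odd d); case: (odd m.+1); move: #|P| => c; nia.
Qed.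

(** * Copying a graph along an injection *)

Section Transfer.

Variables (m n : nat) (g : 'I_m -> 'I_n) (E : graph m).
Hypotheses (g_inj : injective g) (gE : is_graph E).

Definition map_graph : graph n := [set g @: e | e : {set 'I_m} in E].

Lemma card_map_graph : #|map_graph| = #|E|.
Proof. by rewrite card_imset //; apply: imset_inj. Qed.

Lemma map_graph_is_graph : is_graph map_graph.
Proof. by apply/forall_inP => _ /imsetP[e eE ->]; rewrite card_imset // (card_edge gE). Qed.

Lemma map_graph_sub e : e \in map_graph -> e \subset g @: setT.
Proof. by case/imsetP => e0 _ ->; apply: imsetS; apply: subsetT. Qed.

Lemma map_graph_edge a b : ([set g a; g b] \in map_graph) = ([set a; b] \in E).
Proof. by rewrite -!imset_set1 -imsetU mem_imset //; apply: imset_inj. Qed.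

Lemma nbr_map_graph d : (forall v, #|nbr E v| <= d) -> forall v, #|nbr map_graph v| <= d.
Proof.
move=> degE v.
have [/imsetP[a _ ->]|v_out] := boolP (v \in g @: setT); last first.
  suff -> : nbr map_graph v = set0 by rewrite cards0.
  apply/setP => u; rewrite !inE; apply/negP => /map_graph_sub/subsetP/(_ v).
  by rewrite !inE eqxx orbT (negPf v_out) => /(_ isT).
rewrite (leq_trans _ (degE a)) // -(card_imset _ g_inj) subset_leq_card //.
apply/subsetP => u; rewrite inE => uE.
have /imsetP[b _ ub] : u \in g @: setT by rewrite (subsetP (map_graph_sub uE)) // !inE eqxx.
by move: uE; rewrite ub map_graph_edge => bE; apply: imset_f; rewrite inE.
Qed.

(** As both parts are nonempty, each of their vertices lies on an edge, hence in the image of [g],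
    and the parts pull back without loss. *)
Lemma has_Klt_map_graph l t (A B : {set 'I_n}) : 0 < l -> 0 < t ->
  #|A| = l -> #|B| = t -> [disjoint A & B] ->
  {in A & B, forall a b, [set a; b] \in map_graph} -> has_Klt l t E.
Proof.
move=> l0 t0 cA cB dis AB.
have [a0 a0A] : exists a, a \in A by apply/card_gt0P; rewrite cA.
have [b0 b0B] : exists b, b \in B by apply/card_gt0P; rewrite cB.
have Ag : A \subset g @: setT.
  apply/subsetP => a aA; apply: (subsetP (map_graph_sub (AB a b0 aA b0B))).
  by rewrite !inE eqxx.
have Bg : B \subset g @: setT.
  apply/subsetP => b bB; apply: (subsetP (map_graph_sub (AB a0 b a0A bB))).
  by rewrite !inE eqxx orbT.
have preK (C : {set 'I_n}) : C \subset g @: setT -> g @: (g @^-1: C) = C.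
  move=> /subsetP Cg; apply/setP => c; apply/imsetP/idP => [[a]|cC].
    by rewrite inE => ? ->.
  by have /imsetP[a _ ca] := Cg c cC; exists a; rewrite // inE -ca.
apply/existsP; exists (g @^-1: A); apply/existsP; exists (g @^-1: B).
rewrite -(card_imset _ g_inj) preK // cA -[#|g @^-1: B|](card_imset _ g_inj) preK // cB !eqxx /=.
apply/andP; split.
  apply/pred0P => a /=; rewrite !inE; apply/negP => /andP[aA aB].
  by move: (disjointFr dis aA); rewrite aB.
apply/forall_inP => a; rewrite inE => aA; apply/forall_inP => b; rewrite inE => bB.
by rewrite -map_graph_edge AB.
Qed.

End Transfer.

(** * Attaching the outer vertices *)

Lemma exists_ord_inj (T : finType) (A : {set T}) m : #|A| = m ->
  exists2 g : 'I_m -> T, injective g & g @: setT = A.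
Proof.
move=> <-; exists (fun i => enum_val i); first exact: enum_val_inj.
apply/setP => a; apply/imsetP/idP => [[i _ ->]|aA]; first exact: enum_valP.
by exists (enum_rank_in aA a); rewrite ?inE // enum_rankK_in.
Qed.

Lemma exists_inj_in (T U : finType) (u0 : U) (A : {set T}) (B : {set U}) : #|A| <= #|B| ->
  exists h : T -> U, {in A &, injective h} /\ {in A, forall a, h a \in B}.
Proof.
(* Elements are matched by position; the default [u0] is never reached on [A]. *)
move=> cAB; exists (fun a => nth u0 (enum B) (index a (enum A))).
have lt_index a : a \in A -> index a (enum A) < size (enum B).
  by move=> aA; rewrite -cardE (leq_trans _ cAB) // cardE index_mem mem_enum.
split=> [a b aA bA /eqP|a aA]; last by rewrite -mem_enum mem_nth ?lt_index.
rewrite nth_uniq ?lt_index ?enum_uniq // => /eqP.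
by apply: (index_inj a); rewrite mem_enum.
Qed.

(** [J] holds [t - 1] labelled copies of each [l]-subset of [X]. A part [I'] of [I] with [#|J|]
    vertices is injected into [J]; the labels bound the multiplicity of each subset. All other
    vertices get [S], so each vertex of [I'] adds one to the [l - 1] common to all. *)
Lemma exists_attachment l t n (X I S : {set 'I_n}) : 0 < l -> 1 < t ->
  S \subset X -> #|S| = l - 1 -> (t - 1) * 'C(#|X|, l) <= #|I| ->
  exists f : 'I_n -> {set 'I_n},
    [/\ forall y, f y \subset X, forall y, #|f y| <= l,
        forall A : {set 'I_n}, #|A| = l -> #|[set y in I | f y == A]| < t
      & \sum_(y in I) #|f y| = (l - 1) * #|I| + (t - 1) * 'C(#|X|, l)].
Proof.
case: t => [|[|t]] // l0 _ SX cS cI; rewrite subn1 /= in cI *.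
pose draws := [set A : {set 'I_n} | A \subset X & #|A| == l].
pose J : {set {set 'I_n} * 'I_t.+1} := setX draws setT.
have cJ : #|J| = t.+1 * 'C(#|X|, l) by rewrite cardsX cardsT card_ord cards_draws mulnC.
have [I' I'I cI'] : exists2 I' : {set 'I_n}, I' \subset I & #|I'| = #|J|.
  by apply: subset_of_card; rewrite cJ.
have [h [h_inj hJ]] := @exists_inj_in _ _ (set0, ord0) I' J (eq_leq cI').
have h1 y : y \in I' -> (h y).1 \subset X /\ #|(h y).1| = l.
  by move=> /hJ; rewrite !inE andbT => /andP[? /eqP].
exists (fun y => if y \in I' then (h y).1 else S); split.
- by move=> y; case: ifP => // /h1[].
- by move=> y; case: ifP => [/h1[_ ->]//|_]; rewrite cS leq_subr.
- move=> A cA; rewrite ltnS -{2}[t.+1]card_ord -(card_in_imset (f := fun y => (h y).2)).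
    exact: max_card.
  have in_I' y : y \in [set y in I | (if y \in I' then (h y).1 else S) == A] ->
      y \in I' /\ (h y).1 = A.
    rewrite inE; case: ifP => [_ /andP[_ /eqP]//|_ /andP[_ /eqP SA]].
    by move: cA; rewrite -SA cS; lia.
  move=> y z /in_I'[yI yA] /in_I'[zI zA] eq2; apply: h_inj => //.
  by move: yA zA eq2; case: (h y) => a b; case: (h z) => c d /= -> -> ->.
- rewrite (big_setID I') /= (setIidPr I'I).
  rewrite (eq_bigr (fun=> l)) => [|y yI']; last by rewrite yI'; case: (h1 y yI').
  rewrite sum_nat_const (eq_bigr (fun=> l - 1)) => [|y]; last first.
    by rewrite inE => /andP[/negPf-> _].
  rewrite sum_nat_const -cJ -cI'; have := cardsID I' I; rewrite (setIidPr I'I) => <-.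
  move: #|I'| #|I :\: I'| => a b; rewrite -[X in _ * X + _](subnK l0); move: (l - 1) => l'.
  by lia.
Qed.

(** Weight 2 on [X] and 1 on [K] gives every edge weight at least 2; disjoint edges share no
    weight. *)
Lemma matching_bound n (E : graph n) (X K : {set 'I_n}) k :
  {in E, forall e : {set 'I_n}, 2 <= 2 * #|e :&: X| + #|e :&: K|} ->
  2 * #|X| + #|K| < 2 * k -> ~~ has_matching k E.
Proof.
move=> E2 ltk; apply/negP => /existsP[M /and3P[/subsetP ME /eqP cM tM]].
have meet (Y : {set 'I_n}) : \sum_(e in M) #|e :&: Y| <= #|Y|.
  have card_ind (C : {set 'I_n}) : #|C :&: Y| = \sum_(v in C) (if v \in Y then 1 else 0).
    by rewrite -big_mkcondr -sum1_card; apply: eq_bigl => v; rewrite inE.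
  rewrite (eq_bigr _ (fun e _ => card_ind e)).
  by rewrite -(big_trivIset _ tM) /= -card_ind subset_leq_card ?subsetIr.
have : \sum_(e in M) 2 <= \sum_(e in M) (2 * #|e :&: X| + #|e :&: K|).
  by apply: leq_sum => e /ME/E2.
rewrite sum_nat_const cM big_split /= -big_distrr /=.
move: (meet X) (meet K) ltk; move: #|X| #|K| (bigop _ _ _) (bigop _ _ _) => a b c d.
by lia.
Qed.

(** * The join of a sparse graph, an added graph and the attachments *)

Section Construction.

Variables (l t n : nat) (X K : {set 'I_n}) (f : 'I_n -> {set 'I_n}) (H EK : graph n).
Hypotheses (XK : [disjoint X & K]) (lt_l_t : l <= t).
Hypotheses (gH : is_graph H) (HX : forall e, e \in H -> e \subset X)
  (degH : forall v, #|nbr H v| < l).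
Hypotheses (gK : is_graph EK) (EKK : forall e, e \in EK -> e \subset K).
Hypotheses (fX : forall y, f y \subset X) (f_le : forall y, #|f y| <= l)
  (f_mult : forall A : {set 'I_n}, #|A| = l -> #|[set y in ~: X | f y == A]| < t).

Definition spokes : graph n :=
  [set [set p.2; p.1] | p : 'I_n * 'I_n in [set p | (p.1 \in ~: X) && (p.2 \in f p.1)]].

Definition join_graph : graph n := H :|: EK :|: spokes.

Let notinK v : v \in X -> v \notin K.
Proof. by move=> vX; rewrite (disjointFr XK vX). Qed.

Lemma spokesP e : reflect (exists u y, [/\ u \in X, y \notin X, u \in f y & e = [set u; y]])
  (e \in spokes).
Proof.
apply: (iffP imsetP) => [[[y u]]|[u [y [uX yX uy ->]]]].
  rewrite !inE /= => /andP[yX uy] ->; exists u, y.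
  by rewrite (subsetP (fX y)).
by exists (y, u); rewrite // !inE yX.
Qed.

Lemma join_graph_is_graph : is_graph join_graph.
Proof.
apply/forall_inP => e; rewrite inE => /orP[/setUP[/(forall_inP gH)|/(forall_inP gK)]|] //.
case/spokesP => u [y [uX yX _ ->]]; rewrite cards2.
by have /negPf-> : u != y by apply: contraNneq yX => <-.
Qed.

Lemma join_edge_in u v : [set u; v] \in join_graph -> u \in X -> v \in X -> u \in nbr H v.
Proof.
move=> + uX vX; rewrite [u \in nbr _ _]inE => /setUP[/setUP[//|/EKK/subsetP/(_ u)]|].
  by rewrite !inE eqxx (negPf (notinK uX)) => /(_ isT).
case/spokesP => w [y [wX yX _ /setP/(_ y)]]; rewrite !inE eqxx orbT => /orP[]/eqP yE.
  by rewrite yE uX in yX.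
by rewrite yE vX in yX.
Qed.

Lemma join_edge_cross u v : [set u; v] \in join_graph -> u \in X -> v \notin X -> u \in f v.
Proof.
move=> + uX vX => /setUP[/setUP[/HX/subsetP/(_ v)|/EKK/subsetP/(_ u)]|].
- by rewrite !inE eqxx orbT (negPf vX) => /(_ isT).
- by rewrite !inE eqxx (negPf (notinK uX)) => /(_ isT).
case/spokesP => w [y [wX yX wy eqs]].
have yE : y = v.
  have : y \in [set u; v] by rewrite eqs !inE eqxx orbT.
  by rewrite !inE => /orP[]/eqP // yu; rewrite yu uX in yX.
have : u \in [set w; y] by rewrite -eqs !inE eqxx.
by rewrite !inE => /orP[]/eqP uE; [rewrite uE -yE | rewrite -uE uX in yX].
Qed.

Lemma join_edge_out u v : [set u; v] \in join_graph -> u \notin X -> v \notin X ->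
  [set u; v] \in EK.
Proof.
move=> + uX vX => /setUP[/setUP[/HX/subsetP/(_ v)|//]|].
  by rewrite !inE eqxx orbT (negPf vX) => /(_ isT).
case/spokesP => w [y [wX yX wy /setP/(_ w)]]; rewrite !inE eqxx /=.
by case/orP=> /eqP wE; [rewrite wE (negPf uX) in wX | rewrite wE (negPf vX) in wX].
Qed.

Lemma card_join_graph : #|join_graph| = #|H| + #|EK| + \sum_(y in ~: X) #|f y|.
Proof.
have dHK : [disjoint H & EK].
  apply/pred0P => e /=; apply/negP => /andP[eH eK].
  have /card_gt0P[v ve] : 0 < #|e| by rewrite (card_edge gH).
  by move: (notinK (subsetP (HX eH) _ ve)); rewrite (subsetP (EKK eK)).
have dS : [disjoint H :|: EK & spokes].
  apply/pred0P => e /=; apply/negP => /andP[/setUP eHK /spokesP[u [y [uX yX _ eE]]]].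
  have ue : u \in e by rewrite eE !inE eqxx.
  have ye : y \in e by rewrite eE !inE eqxx orbT.
  case: eHK => [/HX/subsetP/(_ y ye)|/EKK/subsetP/(_ u ue)]; first exact/negP.
  exact/negP/notinK.
have /leqifP := leq_card_setU (H :|: EK) spokes; rewrite dS => /eqP->.
have /leqifP := leq_card_setU H EK; rewrite dHK => /eqP->.
congr addn; rewrite card_in_imset => [|[y u] [z w]]; last first.
  rewrite !inE /= => /andP[yX uy] /andP[zX wz] eqs.
  have uX := subsetP (fX y) u uy; have wX := subsetP (fX z) w wz.
  have : u \in [set w; z] by rewrite -eqs !inE eqxx.
  have : y \in [set w; z] by rewrite -eqs !inE eqxx orbT.
  rewrite !inE => /orP[]/eqP yE; first by rewrite yE wX in yX.
  by case/orP => /eqP uE; [rewrite yE uE | rewrite -uE uX in zX].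
under [RHS]eq_bigr => y _ do rewrite -sum1_card.
by rewrite pair_big_dep -sum1_card /=; apply: eq_bigl => -[y u]; rewrite !inE.
Qed.

Lemma join_matching_free k : 2 * #|X| + #|K| < 2 * k -> ~~ has_matching k join_graph.
Proof.
apply: matching_bound => e; rewrite inE => /orP[/setUP[]|].
- by move=> eH; rewrite (setIidPl (HX eH)) (card_edge gH eH).
- by move=> eK; rewrite (setIidPl (EKK eK)) (card_edge gK eK) leq_addl.
case/spokesP => u [y [uX _ _ ->]]; rewrite (leq_trans _ (leq_addr _ _)) // leq_pmulr // card_gt0.
by apply/set0Pn; exists u; rewrite !inE eqxx.
Qed.

(** A common neighbour in [X] would have degree at least [l] in [H]; one outside has [P] inside
    [f b], so [P = f b], and [f_mult] applies. Stated for any [P], it serves either part of a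
    [K_{l,t}]. *)
Lemma join_common_nbr (P Q : {set 'I_n}) : P \subset X -> l <= #|P| -> 0 < #|Q| ->
  {in P & Q, forall a b, [set a; b] \in join_graph} -> #|P| = l /\ #|Q| < t.
Proof.
move=> PX lP /card_gt0P[b0 b0Q] PQ.
have Qf b : b \in Q -> b \notin X /\ P \subset f b.
  move=> bQ; have bX : b \notin X.
    apply/negP => bX; have := degH b; rewrite ltnNge (leq_trans lP) //.
    apply: subset_leq_card; apply/subsetP => a aP.
    by apply: join_edge_in (PQ a b aP bQ) (subsetP PX a aP) bX.
  split=> //; apply/subsetP => a aP.
  exact: join_edge_cross (PQ a b aP bQ) (subsetP PX a aP) bX.
have cP : #|P| = l.
  apply/eqP; rewrite eqn_leq lP andbT (leq_trans _ (f_le b0)) // subset_leq_card //.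
  by case: (Qf b0 b0Q).
split=> //; apply: leq_ltn_trans (f_mult cP); apply: subset_leq_card.
apply/subsetP => b bQ; have [bX Pf] := Qf b bQ.
by rewrite !inE bX eq_sym eqEcard Pf cP f_le.
Qed.

(* A [K_{l,t}] neither part of which lies in [X] stays away from the vertices
   attached to [X] only. *)
Lemma join_Klt (A B : {set 'I_n}) : 0 < l -> #|A| = l -> #|B| = t ->
  {in A & B, forall a b, [set a; b] \in join_graph} ->
  [/\ A \subset X :|: K, B \subset X :|: K, exists2 a, a \in A & a \in K
    & exists2 b, b \in B & b \in K].
Proof.
move=> l0 cA cB AB.
have BA : {in B & A, forall b a, [set b; a] \in join_graph}.
  by move=> b a bB aA; rewrite setUC AB.
have t0 : 0 < t by apply: leq_trans lt_l_t.
have /subsetPn[a aA aX] : ~~ (A \subset X).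
  apply/negP => AX; have B0 : 0 < #|B| by rewrite cB.
  by have [_] := join_common_nbr AX (eq_leq (esym cA)) B0 AB; rewrite cB ltnn.
have /subsetPn[b bB bX] : ~~ (B \subset X).
  apply/negP => BX; have A0 : 0 < #|A| by rewrite cA.
  have lB : l <= #|B| by rewrite cB.
  by have [] := join_common_nbr BX lB A0 BA; rewrite cA cB => ->; rewrite ltnn.
have inK u v : [set u; v] \in join_graph -> u \notin X -> v \notin X -> u \in K.
  move=> uv uX vX; apply: (subsetP (EKK (join_edge_out uv uX vX))).
  by rewrite !inE eqxx.
split.
- apply/subsetP => u uA; rewrite inE; case: (boolP (u \in X)) => //= uX.
  exact: inK (AB u b uA bB) uX bX.
- apply/subsetP => u uB; rewrite inE; case: (boolP (u \in X)) => //= uX.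
  exact: inK (BA u a uB aA) uX aX.
- by exists a => //; apply: inK (AB a b aA bB) aX bX.
- by exists b => //; apply: inK (BA b a bB aA) bX aX.
Qed.

End Construction.

(** * Assembling the bounds *)

Lemma leq_ex n (forb : forall m, graph m -> bool) (E : graph n) :
  is_graph E -> ~~ forb n E -> #|E| <= ex n forb.
Proof. by move=> gE freeE; rewrite /ex leq_bigmax_cond // gE. Qed.

(** The slack of one in the bound on [h] is harmless: [h] is still at least the floor of [L x / 2],
    so [h + c >= L x]. *)
Lemma lower_arith L n x k i T h c e ek (b : bool) : n = x + k + i -> L * x <= (2 * h).+1 ->
  e = h + ek + (k * (if b then L else 0) + (L * i + T)) -> c = (L * x + 1) %/ 2 ->
  L * n + T + ek <= e + c + (if b then 0 else k * L).
Proof.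
move=> -> Lh -> ->.
rewrite !mulnDr; move: (L * x) Lh => p Lh; move: (L * i) => q.
by case: b; rewrite ?muln0 ?[L * k]mulnC; move: (k * L) => r; lia.
Qed.

(* [b] records whether the vertices of the copy of [EK] are joined to the fixed
   [(l - 1)]-subset of [X] ([F1]) or not joined to [X] at all ([F2]). *)
Lemma ex_lower l t s n x k (EK : graph k) (b : bool) :
  1 < l -> l <= t -> l <= x -> x <= s -> k = 2 * (s - x) + 1 -> nx l t s x <= n ->
  is_graph EK -> (if b then k <= t else ~~ has_Klt l t EK) ->
  (l - 1) * n + (t - 1) * 'C(x, l) + #|EK|
  <= ex n (Klt_Ms_free l t s) + ceil2 (x * (l - 1)) + (if b then 0 else k * (l - 1)).
Proof.
move=> l1 lt lx xs kE nxn gEK bP.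
have l0 : 0 < l := ltnW l1.
have ll : l - 1 < l by rewrite subn1 prednK.
have xks : 2 * x + k < 2 * s.+1 by rewrite kE; lia.
have t1 : 1 < t := leq_trans l1 lt.
have nE : x + k + (t - 1) * 'C(x, l) <= n.
  by apply: leq_trans nxn; rewrite /nx kE; move: (_ * 'C(x, l)) => c; lia.
have xkn : x + k <= n by apply: leq_trans nE; apply: leq_addr.
have xn : x <= #|[set: 'I_n]| by rewrite cardsT card_ord (leq_trans _ xkn) // leq_addr.
have [X _ cX] := subset_of_card xn.
have cCX := cardsC X; rewrite card_ord cX in cCX.
have kn : k <= #|~: X| by rewrite -(leq_add2l x) cCX.
have [K KX cK] := subset_of_card kn.
have XK : [disjoint X & K].
  by rewrite disjoint_sym disjoints_subset.
pose I := ~: X :\: K.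
have cI : n = x + k + #|I|.
  by have := cardsID K (~: X); rewrite (setIidPr KX) cK -/I -addnA => ->.
have lX : l - 1 <= #|X| by rewrite cX (leq_trans (leq_subr _ _)).
have [S SX cS] := subset_of_card lX.
have TI : (t - 1) * 'C(#|X|, l) <= #|I| by rewrite cX -(leq_add2l (x + k)) -cI.
have [f0 [f0X f0l f0m f0s]] := exists_attachment l0 t1 SX cS TI.
have [H0 [gH0 degH0 cH0]] : exists H : graph x, [/\ is_graph H, forall v, #|nbr H v| <= l - 1
    & x * (l - 1) <= (2 * #|H|).+1] by apply: near_regular; apply: leq_trans lx.
have [gx gx_inj gxX] := exists_ord_inj cX.
have [gk gk_inj gkK] := exists_ord_inj cK.
pose H := map_graph gx H0; pose EK' := map_graph gk EK.
pose SK := if b then S else set0.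
have SKX : SK \subset X by rewrite /SK; case: (b); rewrite ?sub0set.
have cSK : #|SK| = if b then l - 1 else 0 by rewrite /SK; case: (b); rewrite ?cards0.
pose f y := if y \in K then SK else f0 y.
have gH : is_graph H := map_graph_is_graph gx_inj gH0.
have gK : is_graph EK' := map_graph_is_graph gk_inj gEK.
have HX e : e \in H -> e \subset X by move/map_graph_sub; rewrite gxX.
have EKK e : e \in EK' -> e \subset K by move/map_graph_sub; rewrite gkK.
have degH v : #|nbr H v| < l.
  by rewrite (leq_ltn_trans (nbr_map_graph gx_inj degH0 v)).
have SKl : #|SK| < l by rewrite cSK; case: (b).
have fX y : f y \subset X by rewrite /f; case: ifP.
have fl y : #|f y| <= l by rewrite /f; case: ifP => // _; apply: ltnW.
(* Vertices of [K] are attached to [SK], which has fewer than [l] elements, so they add nothing to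
   the multiplicity. *)
have fm (A : {set 'I_n}) : #|A| = l -> #|[set y in ~: X | f y == A]| < t.
  move=> cA; apply: leq_ltn_trans (f0m A cA); apply: subset_leq_card.
  apply/subsetP => y; rewrite inE => /andP[yX]; rewrite inE /f inE yX.
  case: ifP => _ fA; last by rewrite fA.
  by move: SKl; rewrite (eqP fA) cA ltnn.
pose G := join_graph X f H EK'.
have gG : is_graph G := join_graph_is_graph gH gK fX.
have cG : #|G| = #|H0| + #|EK| + (k * (if b then l - 1 else 0)
    + ((l - 1) * #|I| + (t - 1) * 'C(x, l))).
  rewrite /G (card_join_graph XK gH HX EKK fX) !card_map_graph //; congr addn.
  rewrite (big_setID K) (setIidPr KX) /= -cK -cSK -sum_nat_const -cX -f0s; congr addn.
    by apply: eq_bigr => y yK; rewrite /f yK.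
  by apply: eq_bigr => y /setDP[_ /negPf yK]; rewrite /f yK.
have no_match : ~~ has_matching s.+1 G.
  by apply: (join_matching_free (K := K)) => //; rewrite cX cK.
have no_Klt : ~~ has_Klt l t G.
  apply/negP => /existsP[A /existsP[B /and4P[/eqP cA /eqP cB dAB /forall_inP AB']]].
  have AB : {in A & B, forall a b, [set a; b] \in G}.
    by move=> u v uA vB; apply: (forall_inP (AB' u uA)).
  have [AXK BXK [a0 a0A a0K] [b0 b0B b0K]] :=
    join_Klt XK lt HX degH EKK fX fl fm l0 cA cB AB.
  have kX v : v \in K -> v \notin X by move=> /(subsetP KX); rewrite inE.
  (* A vertex of [A] in [X] is joined to [b0] in [K], whose only neighbours in [X] form [SK]. *)
  have ASK : A \subset SK :|: K.
    apply/subsetP => u uA; have := subsetP AXK u uA; rewrite !inE.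
    case/orP => [uX|->]; last by rewrite orbT.
    by have := join_edge_cross XK HX EKK fX (AB u b0 uA b0B) uX (kX _ b0K); rewrite /f b0K => ->.
  have BSK : B \subset SK :|: K.
    apply/subsetP => u uB; have := subsetP BXK u uB; rewrite !inE.
    case/orP => [uX|->]; last by rewrite orbT.
    have := AB a0 u a0A uB; rewrite setUC => ua.
    by have := join_edge_cross XK HX EKK fX ua uX (kX _ a0K); rewrite /f a0K => ->.
  (* If [b], the [l + t] vertices do not fit into [l - 1 + k <= l - 1 + t]; if not, [SK] is empty
     and the [K_{l,t}] lies in the copy of [EK]. *)
  case: (b) bP ASK BSK cSK {SKX SKl fl fm gG cG no_match AB'} => bP ASK BSK cSK.
    have : #|A :|: B| <= #|SK :|: K| by rewrite subset_leq_card // subUset ASK.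
    have /leqifP := leq_card_setU A B; rewrite dAB => /eqP->.
    rewrite cA cB leqNgt (leq_ltn_trans (leq_card_setU _ _).1) // cK cSK.
    by rewrite -addSn leq_add // ltnW.
  move: ASK BSK; rewrite (cards0_eq cSK) set0U => ASK BSK.
  have AB' : {in A & B, forall a b, [set a; b] \in EK'}.
    move=> u v uA vB; apply: (join_edge_out HX fX (AB u v uA vB)); apply: kX.
      exact: subsetP uA.
    exact: subsetP vB.
  by move: bP; rewrite (has_Klt_map_graph gk_inj l0 (ltnW t1) cA cB dAB AB').
apply: leq_trans (leq_add (leq_add (leq_ex gG _) (leqnn _)) (leqnn _)); last first.
  by rewrite /Klt_Ms_free negb_or no_Klt.
by apply: lower_arith cI _ cG _; rewrite // mulnC.
Qed.

Lemma ex_attained n (forb : forall m, graph m -> bool) : ~~ forb n set0 ->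
  exists E : graph n, [/\ is_graph E, ~~ forb n E & #|E| = ex n forb].
Proof.
move=> free0.
have [|E /andP[gE freeE] exE] := @eq_bigmax_cond _
    (fun E : graph n => is_graph E && ~~ forb n E) (fun E : graph n => #|E|).
  apply/card_gt0P; exists set0; rewrite unfold_in free0 andbT.
  by apply/forall_inP => e; rewrite inE.
by exists E.
Qed.

Lemma has_Klt_set0 l t n : 0 < l -> 0 < t -> ~~ has_Klt l t (set0 : graph n).
Proof.
move=> l0 t0; apply/negP => /existsP[A /existsP[B /and4P[/eqP cA /eqP cB _ /forall_inP AB]]].
have /card_gt0P[a aA] : 0 < #|A| by rewrite cA.
have /card_gt0P[b bB] : 0 < #|B| by rewrite cB.
by have /forall_inP/(_ b bB) := AB a aA; rewrite inE.
Qed.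

Lemma has_matching_set0 k n : 0 < k -> ~~ has_matching k (set0 : graph n).
Proof.
move=> k0; apply/negP => /existsP[M /and3P[]]; rewrite subset0 => /eqP-> .
by rewrite cards0 => /eqP kE; rewrite -kE in k0.
Qed.

(** The added graph is complete; the hypothesis on [2 * x + t] says exactly that it has at most [t]
    vertices. *)
Lemma F1_leq_ex l t s n x : 3 <= l -> l <= t -> nx l t s x <= n ->
  2 * s + 1 <= 2 * x + t -> l <= x -> x <= s ->
  (F1 l t s n x <= (ex n (Klt_Ms_free l t s))%:Z)%R.
Proof.
move=> l3 lt nxn xt lx xs; set k := 2 * (s - x) + 1.
pose EK : graph k := [set e : {set 'I_k} | #|e| == 2].
have gEK : is_graph EK by apply/forall_inP => e; rewrite inE.
have cEK : #|EK| = 'C(k, 2) by rewrite card_draws card_ord.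
have kt : k <= t by rewrite /k; lia.
have := ex_lower (b := true) (ltnW l3) lt lx xs (erefl k) nxn gEK kt.
by rewrite cEK /F1 -/k addn0; move: (ex n _) => a; lia.
Qed.

Lemma F2_leq_ex l t s n x : 3 <= l -> l <= t -> nx l t s x <= n ->
  l <= x -> x <= s ->
  (F2 l t s n x <= (ex n (Klt_Ms_free l t s))%:Z)%R.
Proof.
move=> l3 lt nxn lx xs; set k := 2 * (s - x) + 1.
have l0 : 0 < l by apply: ltn_trans l3.
have [EK [gEK freeEK cEK]] := @ex_attained k (Klt_free l t) (has_Klt_set0 k l0 (leq_trans l0 lt)).
have := ex_lower (b := false) (ltnW l3) lt lx xs (erefl k) nxn gEK freeEK.
rewrite cEK /F2 -/k /=; move: (k * _) (ex k _) (ex n _) => a b c.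
by lia.
Qed.

(** The bound by [r_1] and [r_2] is stated for each term of the maxima, with [t] moved across to
    avoid truncated subtraction. *)
Theorem theorem1p1 (l t : nat) :
  3 <= l -> l <= t ->
  (forall s n : nat, l + 1 <= s -> 2 * s + 1 <= n -> n1 l t s <= n ->
     (forall x : nat, 2 * s + 1 <= 2 * x + t -> 2 * l <= 2 * x -> 2 * x <= 2 * s ->
        (F1 l t s n x <= (ex n (Klt_Ms_free l t s))%:Z)%R) /\
     (forall x : nat, 2 * l <= 2 * x -> 2 * x + t <= 2 * s ->
        (F2 l t s n x <= (ex n (Klt_Ms_free l t s))%:Z)%R)) /\
  (exists s0 : nat, forall s n : nat, s0 <= s -> l + 1 <= s -> 2 * s + 1 <= n ->
     2 * 'C(3 * s, 2) <= n ->
     ((ex n (Klt_Ms_free l t s))%:Z <=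
        ((l - 1) * n + (t - 1) * 'C(s, l))%:Z - (ceil2 (s * (l - 1)))%:Z)%R).
Proof.
move=> l3 lt; split.
  move=> s n _ _ n1n.
  have nxn x : x <= s -> nx l t s x <= n.
    by move=> xs; apply: leq_trans n1n; apply: (leq_bigmax (Ordinal (_ : x < s.+1))).
  split=> x.
    move=> xt; rewrite !leq_pmul2l // => lx xs.
    exact: F1_leq_ex (nxn x xs) xt lx xs.
  rewrite leq_pmul2l // => lx xt; have xs : x <= s by lia.
  exact: F2_leq_ex (nxn x xs) lx xs.
(* The threshold is that of [bin_large]. *)
exists (20 * l) => s n ls _ _ _.
have l0 : 0 < l := ltn_trans (isT : 0 < 2) l3.
have [|E [gE]] := @ex_attained n (Klt_Ms_free l t s).
  by rewrite /Klt_Ms_free negb_or has_Klt_set0 ?has_matching_set0 // (leq_trans l0).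
rewrite negb_or => /andP[freeE nomat] <-.
by have := card_edges_upper l3 lt ls gE freeE nomat; lia.
Qed.
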